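(* Let $\alpha>1$ and let $K^\alpha$ be the Cantor set defined in the context. Suppose that for each $s\in\mathbb N$ the set $Z_s=(x_{k,s})_{k=1}^{2^s-1}$ of $2^s-1$ distinct points of $K^\alpha$ is uniformly distributed on $K^\alpha$. Then $\Lambda_{2^s-1}(Z_s,K^\alpha)\to\infty$ as $s\to\infty$.
   Context: Geometrically symmetric Cantor sets: let $(\ell_s)_{s\ge 0}$ be a sequence of positive numbers with $\ell_0=1$ and $3\ell_{s+1}\le \ell_s$ for all $s\ge 0$. Put $E_0=I_{1,0}=[0,1]$; given $E_s=\bigcup_{j=1}^{2^s} I_{j,s}$, a disjoint union of closed intervals (''basic intervals of level $s$'') of length $\ell_s$ (numbered from left to right), $E_{s+1}$ is obtained by replacing each $I_{j,s}$ by two closed subintervals $I_{2j-1,s+1}$ and $I_{2j,s+1}$ of length $\ell_{s+1}$, the first sharing the left endpoint and the second the right endpoint of $I_{j,s}$. The associated Cantor set is $K=\bigcap_{s\ge0}E_s$. The set $K^\alpha$ ($\alpha>1$) is the Cantor set associated with $\ell_0=1$, $\ell_s=\ell_1^{\alpha^{s-1}}$ for $s\ge1$, where $\ell_1>0$ is a fixed number with $\ell_1\le 1/3$ and $\ell_1^{\alpha-1}\le 1/3$ (equivalently $\alpha\ge(\log\ell_1-\log 3)/\log\ell_1$). Uniform distribution: for a finite set $Z\subset K$ let $m_{j,k}(Z)=\#(Z\cap I_{j,k})$. $Z$ is uniformly distributed on $K$ if $|m_{i,k}(Z)-m_{j,k}(Z)|\le 1$ for every $k\in\mathbb N$ and all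 $i,j\in\{1,\dots,2^k\}$. Lebesgue constant: for a set $Z=\{x_1,\dots,x_N\}$ of $N$ distinct points of a compact set $K\subset\mathbb R$, let $l_k(x)=\prod_{i\ne k}\frac{x-x_i}{x_k-x_i}$ ($1\le k\le N$) and $\Lambda_N(Z,K)=\sup_{x\in K}\sum_{k=1}^N|l_k(x)|$. *)

(* Defs.v *)
From mathcomp Require Import all_boot all_order all_algebra.
From mathcomp Require Import all_classical all_reals all_analysis.
Import Order.TTheory GRing.Theory Num.Theory.
Import numFieldNormedType.Exports.

Set Implicit Arguments.
Unset Strict Implicit.
Unset Printing Implicit Defensive.

Local Open Scope classical_set_scope.
Local Open Scope ring_scope.

Section CantorSets.
Variables (R : realType) (ell : nat -> R).

(* Left endpoint of the j-th basic interval of level s, for 1 <= j <= 2 ^ s.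
   The two children of interval j are 2j-1 and 2j, so the parent of interval j
   is uphalf j, and j is a right-hand child exactly when j is even. *)
Fixpoint basic_left (j s : nat) : R :=
  if s is s'.+1 then
    basic_left (uphalf j) s' + (if odd j then 0 else ell s' - ell s)
  else 0.

Definition basic_interval (j s : nat) : interval R :=
  `[basic_left j s, basic_left j s + ell s].

Definition cantor_level (s : nat) : set R :=
  \bigcup_(j in [set j | (1 <= j <= 2 ^ s)%N]) [set` basic_interval j s].

Definition cantor_set : set R := \bigcap_s cantor_level s.

(* A finite set of N points is given as an injective family x : 'I_N -> R;
   injectivity is required separately, and makes this count the number of
   points of the set in the interval. *)
Definition basic_count (N : nat) (x : 'I_N -> R) (j k : nat) : nat :=
  #|[set i : 'I_N | x i \in basic_interval j k]%SET|.

Definition uniformly_distributed (N : nat) (x : 'I_N -> R) : Prop :=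
  forall k i j : nat, (1 <= i <= 2 ^ k)%N -> (1 <= j <= 2 ^ k)%N ->
    `|(basic_count x i k)%:Z - (basic_count x j k)%:Z| <= 1.

End CantorSets.

Definition ell_alpha (R : realType) (alpha l1 : R) (s : nat) : R :=
  if s is s'.+1 then l1 `^ (alpha ^+ s') else 1.

Definition cantor_alpha (R : realType) (alpha l1 : R) : set R :=
  cantor_set (ell_alpha alpha l1).

Definition lagrange_basis (R : realType) (N : nat) (x : 'I_N -> R) (k : 'I_N)
    (t : R) : R :=
  \prod_(i < N | i != k) ((t - x i) / (x k - x i)).

(* The supremum is taken in the extended reals, so that it needs no
   boundedness side condition; it is finite when K is compact and nonempty. *)
Definition lebesgue_constant (R : realType) (N : nat) (x : 'I_N -> R)
    (K : set R) : \bar R :=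
  ereal_sup [set (\sum_(k < N) `|lagrange_basis x k t|)%:E | t in K].

(* Main.v *)
Require Import Defs.
From mathcomp Require Import all_boot all_order all_algebra.
From mathcomp Require Import all_classical all_reals all_analysis.
From mathcomp Require Import zify lra ring.
Import Order.TTheory GRing.Theory Num.Theory.
Import numFieldNormedType.Exports.

Local Open Scope classical_set_scope.
Local Open Scope ring_scope.

(** Since [Z_s] has [2^s - 1] points, uniform distribution leaves exactly one basic
    interval [a] of level [s] empty and puts one point in each of the others.
    Let [t] be the left endpoint of [a]. Fix [m] and let [x_k] be one of the
    [2^m - 1] points in the level [s - m] ancestor of [a], lying in the interval
    [b] of level [s]. The automorphism of the binary tree that exchanges [a] and
    [b] (xor with [a xor b]) matches the factors of the numerator
    [prod |t - x_i|] of [|l_k(t)|] with those of its denominator up to a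
    factor [1 - 6 ell_(s-m) / ell_(s-m-1)]. These ratios of lengths decay faster
    than [2^(-s)], so the product of all corrections tends to [1] and
    [|l_k(t)| >= 1/2] for large [s]. Hence the Lebesgue constant is eventually at
    least [(2^m - 1) / 2], for every [m]. *)

(** * Addresses of basic intervals in the binary tree *)

Section BinaryTree.
Local Open Scope nat_scope.

(** Labels of a level start at [0], so the parent of [c] is [c./2] and [ancestor n] forgets the last
    [n] binary digits. *)
Definition ancestor (n c : nat) : nat := iter n half c.

Lemma ancestorS n c : ancestor n.+1 c = ancestor n c./2.
Proof. exact: iterSr. Qed.

Lemma ancestorD k n c : ancestor (k + n) c = ancestor k (ancestor n c).
Proof. exact: iterD. Qed.

Lemma ancestor_eq0 s c : (ancestor s c == 0) = (c < 2 ^ s).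
Proof.
elim: s c => [|s IHs] c; first by rewrite expn0 ltnS leqn0.
by rewrite ancestorS IHs expnS mul2n ltn_half_double.
Qed.

Lemma ancestor_block m q r : r < 2 ^ m -> ancestor m (q * 2 ^ m + r) = q.
Proof.
elim: m r => [|m IHm] r; first by rewrite expn0 muln1 ltnS leqn0 => /eqP ->; rewrite addn0.
rewrite expnS mul2n => r_lt; rewrite ancestorS halfD -doubleMr odd_double doubleK.
by rewrite add0n IHm // ltn_half_double.
Qed.

(** Finds the last common ancestor, [n.+1] generations up; its level will determine the distance
    between points with these addresses. *)
Lemma ancestor_split s c d : ancestor s c = ancestor s d -> c <> d ->
  exists n, [/\ n < s, ancestor n c <> ancestor n d
    & ancestor n.+1 c = ancestor n.+1 d].
Proof.
elim: s => [|s IHs] // eqS neq.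
have [eqs|/eqP neqs] := eqVneq (ancestor s c) (ancestor s d); last by exists s.
by have [n [lt_ns ? ?]] := IHs eqs neq; exists n; split=> //; apply: ltnW.
Qed.

(* The automorphism of the binary tree acting on labels as xor with
   [a xor b], on the lowest [m] bits. *)
Fixpoint flip (m a b c : nat) : nat :=
  if m is m'.+1 then
    (odd c (+) (odd a (+) odd b)) + (flip m' a./2 b./2 c./2).*2
  else c.

Lemma flip_half m a b c : (flip m.+1 a b c)./2 = flip m a./2 b./2 c./2.
Proof. exact: half_bit_double. Qed.

Lemma flipK m a b : involutive (flip m a b).
Proof.
elim: m a b => [|m IHm] a b c //.
by rewrite /= half_bit_double oddD odd_double oddb addbF addbK IHm odd_double_half.
Qed.

Lemma flip_left m a b : ancestor m a = ancestor m b -> flip m a b a = b.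
Proof.
elim: m a b => [|m IHm] a b //; rewrite !ancestorS => /IHm /= ->.
by rewrite addKb odd_double_half.
Qed.

Lemma ancestor_flip m a b c : ancestor m (flip m a b c) = ancestor m c.
Proof.
by elim: m a b c => [|m IHm] a b c //; rewrite !ancestorS flip_half IHm.
Qed.

(** Whether a digit changes depends only on its position, so [flip] preserves the level at which two
    addresses part. *)
Lemma ancestor_flip_eq m a b n c d : ancestor n c = ancestor n d ->
  ancestor n (flip m a b c) = ancestor n (flip m a b d).
Proof.
elim: n m a b c d => [|n IHn] [|m] a b c d; rewrite ?ancestorS ?flip_half //.
  by move=> /= ->.
exact: IHn.
Qed.

Lemma flip_lt m k a b c : c < 2 ^ (m + k) -> flip m a b c < 2 ^ (m + k).
Proof.
by rewrite -!ancestor_eq0 addnC !ancestorD ancestor_flip.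
Qed.

End BinaryTree.

(** Serves to bound the total loss in a product whose factors each lose a proportion [delta]. *)
Lemma bernoulli_le (R : realDomainType) (delta : R) n : 0 <= delta <= 1 ->
  1 - n%:R * delta <= (1 - delta) ^+ n.
Proof.
move=> /andP[d0 d1]; elim: n => [|n IHn]; first by rewrite expr0; lra.
rewrite exprSr; apply: le_trans (ler_wpM2r _ IHn); last by rewrite subr_ge0.
have : 0 <= n%:R * (delta * delta) by rewrite !mulr_ge0.
by rewrite -natr1; lra.
Qed.

(** * Distances between points of basic intervals *)

Section BasicIntervals.
Variables (R : realType) (ell : nat -> R).
Hypothesis ell_gt0 : forall s, 0 < ell s.
Hypothesis ell_third : forall s, 3 * ell s.+1 <= ell s.

Let cell (c s : nat) : interval R := basic_interval ell c.+1 s.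

Lemma cellE c s y :
  (y \in cell c s) = (basic_left ell c.+1 s <= y <= basic_left ell c.+1 s + ell s).
Proof. by rewrite /cell /basic_interval in_itv. Qed.

Lemma basic_left_child c s : basic_left ell c.+1 s.+1 =
  basic_left ell c./2.+1 s + (if odd c then ell s - ell s.+1 else 0).
Proof. by rewrite /=; case: (odd c). Qed.

Lemma cell_half c s y : y \in cell c s.+1 -> y \in cell c./2 s.
Proof.
rewrite !cellE basic_left_child => /andP[].
have := ell_gt0 s.+1; have := ell_third s.
by case: (odd c) => *; apply/andP; split; lra.
Qed.

Lemma cell_ancestor n c s y : y \in cell c (n + s) -> y \in cell (ancestor n c) s.
Proof. by elim: n c => [|n IHn] c // /cell_half /IHn; rewrite ancestorS. Qed.

Lemma cell_dist_le c s y z : y \in cell c s -> z \in cell c s -> `|y - z| <= ell s.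
Proof. by rewrite !cellE => /andP[? ?] /andP[? ?]; rewrite ler_norml; lra. Qed.

Lemma cell_dist_ge c d s y z : c <> d -> c./2 = d./2 ->
  y \in cell c s.+1 -> z \in cell d s.+1 -> ell s - 2 * ell s.+1 <= `|y - z|.
Proof.
move=> neq eqh; rewrite !cellE !basic_left_child eqh.
have : odd c != odd d.
  by apply/eqP=> eqo; apply: neq; rewrite -(odd_double_half c) eqo eqh odd_double_half.
by case: (odd c) (odd d) => [] [] // _ /andP[? ?] /andP[? ?]; rewrite ler_normr; lra.
Qed.

(** The last common interval has level [s]; the points lie in its two children, which sit at its
    opposite ends. *)
Lemma cell_split_dist n c d s y z :
  ancestor n c <> ancestor n d -> ancestor n.+1 c = ancestor n.+1 d ->
  y \in cell c (n + s.+1) -> z \in cell d (n + s.+1) ->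
  ell s - 2 * ell s.+1 <= `|y - z| <= ell s.
Proof.
move=> neq eqS yc zd; apply/andP; split.
  by apply: cell_dist_ge (cell_ancestor _ _ _ _ yc) (cell_ancestor _ _ _ _ zd).
rewrite -addSnnS in yc zd; have := cell_ancestor _ _ _ _ zd; rewrite -eqS.
exact/cell_dist_le/cell_ancestor.
Qed.

Lemma ell_decr n k : ell (k + n)%N <= ell n.
Proof.
elim: k => [|k IHk] //; apply: le_trans IHk; rewrite addSn.
by have := ell_third (k + n); have := ell_gt0 (k + n).+1; lra.
Qed.

(* Swapping [a] and [b] by [flip] almost preserves distances: within a block of
   level [r.+1] both distances are essentially [ell] of the splitting level, and
   outside the block the points moved by at most [2 * ell r.+1]. *)
Lemma flip_dist_ratio (r m : nat) (delta : R) (X : nat -> R) (a b c : nat) :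
  (forall j, (r <= j)%N -> 6 * ell j.+1 <= delta * ell j) ->
  (forall d, (d < 2 ^ (m + r.+1))%N -> X d \in cell d (m + r.+1)) ->
  (a < 2 ^ (m + r.+1))%N -> (b < 2 ^ (m + r.+1))%N -> (c < 2 ^ (m + r.+1))%N ->
  ancestor m a = ancestor m b -> c <> a ->
  (1 - delta) * `|X b - X (flip m a b c)| <= `|X a - X c|.
Proof.
move=> small Xcell a_lt b_lt c_lt eqab neqca.
set s := (m + r.+1)%N in Xcell a_lt b_lt c_lt *.
have top d : (d < 2 ^ s)%N -> ancestor s d = 0%N by rewrite -ancestor_eq0 => /eqP.
have c'_lt : (flip m a b c < 2 ^ s)%N by apply: flip_lt.
set c' := flip m a b c in c'_lt *.
have [n [lt_ns neqn eqn]] : exists n, [/\ (n < s)%N, ancestor n a <> ancestor n c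
    & ancestor n.+1 a = ancestor n.+1 c].
  by apply: ancestor_split (nesym neqca); rewrite !top.
have fab : flip m a b a = b by apply: flip_left.
have eqn' : ancestor n.+1 b = ancestor n.+1 c'.
  by rewrite -fab; apply: ancestor_flip_eq.
have neqn' : ancestor n b <> ancestor n c'.
  by move=> /(ancestor_flip_eq m a b); rewrite -{2}fab !flipK; apply: neqn.
have [j sE] : exists j, s = (n + j.+1)%N by exists (s - n.+1)%N; lia.
have [Xa Xb Xc Xc'] : [/\ X a \in cell a s, X b \in cell b s, X c \in cell c s
   & X c' \in cell c' s] by split; apply: Xcell.
have /andP[lowa upa] : ell j - 2 * ell j.+1 <= `|X a - X c| <= ell j.
  by move: Xa Xc; rewrite sE; apply: cell_split_dist.
have /andP[lowb upb] : ell j - 2 * ell j.+1 <= `|X b - X c'| <= ell j.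
  by move: Xb Xc'; rewrite sE; apply: cell_split_dist.
have ej := ell_gt0 j; have ej1 := ell_gt0 j.+1; have tj := ell_third j.
have delta_gt0 : 0 < delta.
  rewrite -(pmulr_lgt0 _ (ell_gt0 r)); apply: lt_le_trans (small r _) => //.
  by rewrite mulr_gt0.
(* Both pairs part below an interval of the same level [j]. For [r <= j] the bounds
   [ell j - 2 * ell j.+1] and [ell j] are close enough. *)
have [le_rj|lt_jr] := leqP r j.
  have := small j le_rj.
  have [d1|/ltW d1] := leP 1 delta.
    have : (1 - delta) * `|X b - X c'| <= 0 by rewrite mulr_le0_ge0 // subr_le0.
    by lra.
  have : (1 - delta) * `|X b - X c'| <= (1 - delta) * ell j.
    by rewrite ler_wpM2l // subr_ge0.
  by lra.
(* For [j < r] the two distances differ by at most [2 * ell r.+1], while [X b] and [X c'] are at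
   least [ell r / 3] apart; this is the source of the constant [6 = 2 * 3]. *)
have eqcc' : ancestor m c = ancestor m c' by rewrite ancestor_flip.
have dab : `|X a - X b| <= ell r.+1.
  apply: (@cell_dist_le (ancestor m a)); first exact: cell_ancestor.
  by rewrite eqab; apply: cell_ancestor.
have dcc : `|X c - X c'| <= ell r.+1.
  apply: (@cell_dist_le (ancestor m c)); first exact: cell_ancestor.
  by rewrite eqcc'; apply: cell_ancestor.
have tri : `|X b - X c'| <= `|X a - X b| + `|X a - X c| + `|X c - X c'|.
  have -> : X b - X c' = - (X a - X b) + (X a - X c) + (X c - X c') by ring.
  by rewrite -(normrN (X a - X b)); do 2![apply: le_trans (ler_normD _ _) _ => //; rewrite ?lerD2r //].
have erj : ell r <= ell j by rewrite -(subnK (ltnW lt_jr)) ell_decr.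
have : delta * (ell r / 3) <= delta * `|X b - X c'|.
  by rewrite ler_wpM2l ?(ltW delta_gt0) //; lra.
by have := small r (leqnn r); lra.
Qed.


(** * Disjointness of the intervals, and their left endpoints *)

Lemma cell_inj c d s y : (c < 2 ^ s)%N -> (d < 2 ^ s)%N ->
  y \in cell c s -> y \in cell d s -> c = d.
Proof.
rewrite -!ancestor_eq0 => /eqP c0 /eqP d0 yc yd; apply: contrapT => neq.
have [n [lt_ns neqn eqn]] := ancestor_split _ _ _ (etrans c0 (esym d0)) neq.
have sE : s = (n + (s - n.+1).+1)%N by lia.
rewrite sE in yc yd.
have /andP[] := cell_split_dist _ _ _ _ _ _ neqn eqn yc yd; rewrite subrr normr0.
by have := ell_third (s - n.+1); have := ell_gt0 (s - n.+1); lra.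
Qed.

Lemma basic_left_double n c s :
  basic_left ell (iter n double c).+1 (n + s) = basic_left ell c.+1 s.
Proof.
elim: n => [|n IHn] //; rewrite addSn [iter _ _ _]/= basic_left_child.
by rewrite odd_double doubleK addr0.
Qed.

Lemma ancestor_iter_double n c : ancestor n (iter n double c) = c.
Proof. by elim: n => [|n IHn] //; rewrite ancestorS [iter _ _ _]/= doubleK. Qed.

Lemma basic_left_cantor c s : (c < 2 ^ s)%N ->
  cantor_set ell (basic_left ell c.+1 s).
Proof.
(* Going down [k] left children keeps the left endpoint and reaches level [k + s]; going up [s]
   levels gives the interval of level [k], whether [k] is below [s] or not. *)
move=> c_lt k _; exists (ancestor s (iter k double c)).+1 => /=.
  rewrite -ancestor_eq0 -ancestorD addnC ancestorD ancestor_iter_double.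
  by rewrite ancestor_eq0.
apply: (cell_ancestor s); rewrite addnC cellE basic_left_double lexx lerDl.
exact: ltW.
Qed.

(** * Lower bounds for the Lagrange basis and the Lebesgue sum *)

Lemma flip_prod_ratio (r m : nat) (X : nat -> R) (a b : 'I_(2 ^ (m + r.+1))) :
  (forall j, (r <= j)%N -> 2 ^+ (m + r.+1).+1 * (6 * ell j.+1) <= ell j) ->
  (forall d, (d < 2 ^ (m + r.+1))%N -> X d \in cell d (m + r.+1)) ->
  ancestor m a = ancestor m b ->
  1 / 2 * \prod_(c < 2 ^ (m + r.+1) | (c != a) && (c != b)) `|X b - X c|
    <= \prod_(c < 2 ^ (m + r.+1) | (c != a) && (c != b)) `|X a - X c|.
Proof.
set s := (m + r.+1)%N => small Xcell eqab.
(* With at most [2 ^ s] factors, this choice keeps the total loss in Bernoulli's inequality at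
   [1 / 2] or less. *)
pose delta : R := (2 ^+ s.+1)^-1.
have pow_gt0 : 0 < 2 ^+ s.+1 :> R by rewrite exprn_gt0.
have delta_gt0 : 0 < delta by rewrite invr_gt0.
have delta_le1 : delta <= 1 by rewrite invf_le1 // exprn_ege1 // ler1n.
have small' j : (r <= j)%N -> 6 * ell j.+1 <= delta * ell j.
  by move=> /small; rewrite -ler_pdivlMl.
pose sigma (c : 'I_(2 ^ s)) : 'I_(2 ^ s) := Ordinal (flip_lt m r.+1 a b c (ltn_ord c)).
have sigmaK : involutive sigma by move=> c; apply/val_inj/flipK.
have sigma_a : sigma a = b by apply/val_inj/flip_left.
have sigma_b : sigma b = a by rewrite -sigma_a sigmaK.
(* The index set is invariant because [sigma] exchanges the two excluded addresses [a] and [b]. *)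
rewrite (reindex_inj (can_inj sigmaK)) /=.
under eq_bigl => c.
  rewrite -[X in _ != X]sigma_b -[X in _ && (_ != X)]sigma_a.
  rewrite !(inj_eq (can_inj sigmaK)) andbC; over.
apply: (@le_trans _ _ (\prod_(c < 2 ^ s | (c != a) && (c != b))
    ((1 - delta) * `|X b - X (flip m a b c)|))); last first.
  apply: ler_prod => c /andP[/eqP neq _]; rewrite mulr_ge0 ?subr_ge0 //=.
  by apply: (flip_dist_ratio r) => // /val_inj.
rewrite big_split /= ler_wpM2r ?prodr_ge0 // prodr_const.
set p := #|_|; have p_le : (p <= 2 ^ s)%N by rewrite -[leqRHS]card_ord max_card.
apply: le_trans (bernoulli_le _ _ _ _); last by rewrite delta_le1 ltW.
have : p%:R * delta <= (2 ^ s)%:R * delta by rewrite ler_wpM2r ?ler_nat ?ltW.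
have -> : (2 ^ s)%:R * delta = 1 / 2.
  by rewrite natrX /delta exprS invfM mulrCA divff ?mulr1 ?mul1r // lt0r_neq0 ?exprn_gt0.
by lra.
Qed.

Lemma card_block m s (a : 'I_(2 ^ s)) : (m <= s)%N ->
  (2 ^ m <= #|[set c : 'I_(2 ^ s) | ancestor m c == ancestor m a]%SET|)%N.
Proof.
move=> le_ms; have block_lt (i : 'I_(2 ^ m)) :
    (ancestor m a * 2 ^ m + i < 2 ^ s)%N.
  rewrite -ancestor_eq0 -{1}(subnK le_ms) ancestorD ancestor_block //.
  by rewrite -ancestorD subnK // ancestor_eq0.
pose f i : 'I_(2 ^ s) := Ordinal (block_lt i).
have f_inj : injective f.
  by move=> i j [] /eqP; rewrite eqn_add2l => /eqP /val_inj.
rewrite -[leqLHS]card_ord -cardsT -(card_imset _ f_inj).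
apply/subset_leq_card/fintype.subsetP => _ /imsetP[i _ ->].
by rewrite inE ancestor_block.
Qed.

(** By the pigeonhole principle some interval [a] is empty; uniformity then allows at most one point
    in every other interval, and counting shows that all of them are occupied. *)
Lemma uniform_addresses s (x : 'I_(2 ^ s - 1) -> R) :
  (forall k, cantor_set ell (x k)) -> uniformly_distributed ell x ->
  exists (a : 'I_(2 ^ s)) (addr : 'I_(2 ^ s - 1) -> 'I_(2 ^ s)),
    [/\ injective addr, codom addr =i predC1 a
      & forall k, x k \in cell (addr k) s].
Proof.
move=> xK unif.
have [addr addrP] : {addr : 'I_(2 ^ s - 1) -> 'I_(2 ^ s) &
    forall k, x k \in cell (addr k) s}.
  apply: (@choice _ _ (fun k c => x k \in cell (nat_of_ord c) s)) => k.
  have [[|j] //= j_le xj] := xK k s I.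
  by exists (Ordinal j_le).
have card_lt : (#|codom addr| < #|'I_(2 ^ s)|)%N.
  apply: leq_ltn_trans (leq_image_card _ _) _.
  by rewrite !card_ord ltn_subrL expn_gt0.
have [a a_out] : exists a, a \notin codom addr.
  by apply/existsP; rewrite -negb_forall; apply: contraL card_lt => /forallP im;
     rewrite -leqNgt; apply/subset_leq_card/fintype.subsetP => c _; apply: im.
have count_a : basic_count ell x a.+1 s = 0%N.
  apply/eq_card0 => k; rewrite inE; apply: contraNF a_out => xka.
  apply/codomP; exists k; apply/val_inj => /=.
  exact: cell_inj (ltn_ord _) (ltn_ord _) xka (addrP k).
have addr_inj : injective addr.
  move=> i j eqij; apply/eqP; apply: contraT => neq.
  have := unif s (addr i).+1 a.+1 (ltn_ord (addr i)) (ltn_ord a).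
  rewrite count_a subr0 ger0_norm // lez_nat leqNgt => /negP[].
  apply: (@leq_trans #|[set i; j]%SET|); first by rewrite cards2 neq.
  apply/subset_leq_card/fintype.subsetP => k; rewrite !inE => /orP[] /eqP ->.
    exact: addrP.
  by rewrite eqij; apply: addrP.
exists a, addr; split=> //; apply/subset_cardP.
  by rewrite card_codom // cardC1 !card_ord subn1.
by apply/fintype.subsetP => c c_in; rewrite !inE; apply: contra a_out => /eqP <-.
Qed.

Lemma lebesgue_sum_ge r m (x : 'I_(2 ^ (m + r.+1) - 1) -> R) :
  (forall j, (r <= j)%N -> 2 ^+ (m + r.+1).+1 * (6 * ell j.+1) <= ell j) ->
  injective x -> (forall k, cantor_set ell (x k)) ->
  uniformly_distributed ell x ->
  exists2 t, cantor_set ell t &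
    (2 ^+ m - 1) / 2 <= \sum_k `|lagrange_basis x k t|.
Proof.
set s := (m + r.+1)%N in x * => small x_inj xK unif.
have [a [addr [addr_inj addr_im addr_cell]]] := uniform_addresses s x xK unif.
pose t := basic_left ell a.+1 s.
exists t; first exact: basic_left_cantor.
have addr_neq k : addr k != a.
  by have := codom_f addr k; rewrite addr_im.
have addr_onto c : c != a -> exists k, c = addr k.
  by move=> neq; apply/codomP; rewrite addr_im.
(* Extends the nodes to one point per interval of level [s], with [t] filling the empty one, so that
   [flip_prod_ratio] applies. *)
pose X (c : nat) := if [pick k | addr k == c :> nat] is Some k then x k else t.
have Xa : X a = t.
  by rewrite /X; case: pickP => // k; rewrite (inj_eq val_inj) (negPf (addr_neq k)).
have Xaddr k : X (addr k) = x k.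
  rewrite /X; case: pickP => [i /eqP/val_inj/addr_inj -> //|/(_ k)].
  by rewrite eqxx.
have Xcell d : (d < 2 ^ s)%N -> X d \in cell d s.
  move=> d_lt; pose c := Ordinal d_lt; rewrite -[d]/(nat_of_ord c).
  have [->|/addr_onto[k ->]] := eqVneq c a; last by rewrite Xaddr.
  by rewrite Xa cellE lexx lerDl ltW.
pose B := [set k | ancestor m (addr k) == ancestor m a]%SET.
have basis_ge k : k \in B -> 1 / 2 <= `|lagrange_basis x k t|.
  rewrite inE => /eqP eqk.
  have := flip_prod_ratio r m X a (addr k) small Xcell (esym eqk).
  have reix (F : nat -> R) :
      \prod_(c < 2 ^ s | (c != a) && (c != addr k)) F c
        = \prod_(i | i != k) F (addr i).
    rewrite -[RHS](big_imset (h := addr) (fun c => F c)) /=; last first.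
      by move=> ? ? _ _; apply: addr_inj.
    apply: eq_bigl => c; apply/andP/imsetP => [[/addr_onto[i ->]]|[i neq ->]].
      by rewrite (inj_eq addr_inj) => neq; exists i.
    by rewrite addr_neq (inj_eq addr_inj).
  rewrite (reix (fun c => `|X (addr k) - X c|)) (reix (fun c => `|X a - X c|)).
  under eq_bigr do rewrite !Xaddr.
  under [X in _ <= X]eq_bigr do rewrite Xaddr Xa.
  rewrite /lagrange_basis normr_prod.
  under [X in _ -> _ <= X]eq_bigr do rewrite normrM normfV.
  rewrite prodf_div ler_pdivlMr // prodr_gt0 // => i neq.
  by rewrite normr_gt0 subr_eq0 (inj_eq x_inj) eq_sym.
(* The block has at least [2 ^ m] addresses, and only [a] carries no node. *)
have card_B : (2 ^ m - 1 <= #|B|)%N.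
  have := card_block m s a (leq_addr _ _).
  rewrite (cardsD1 a) inE eqxx -(card_imset _ addr_inj) => le_m.
  rewrite leq_subLR; apply: leq_trans le_m _; rewrite leq_add2l.
  apply/subset_leq_card/fintype.subsetP => c; rewrite !inE => /andP[/addr_onto[k ->] eqk].
  by rewrite imset_f // inE.
apply: (@le_trans _ _ (\sum_(k in B) (1 / 2 : R))).
  rewrite sumr_const -[leRHS]mulr_natl mul1r ler_wpM2r ?invr_ge0 //.
  by rewrite -natrX lerBlDr natr1 ler_nat; lia.
rewrite [leRHS](bigID (mem B)) /=; apply: ler_wpDr; first exact: sumr_ge0.
exact: ler_sum.
Qed.

End BasicIntervals.

(** * Superexponential decay of the ratios of lengths *)

Lemma expR_superexp (R : realType) (alpha K C : R) : 1 < alpha -> 0 < K ->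
  exists n0, forall n, (n0 <= n)%N -> C * 2 ^+ n <= expR (K * alpha ^+ n).
Proof.
move=> alpha_gt1 K_gt0; pose eta := Num.sqrt alpha - 1.
(* Writing [alpha] as the square of [1 + eta] makes [alpha ^+ n] at least quadratic in [n], which
   beats the linear exponent [|C| + n]. *)
have eta_gt0 : 0 < eta by rewrite subr_gt0 -sqrtr1 ltr_sqrt // (lt_trans ltr01).
have growth n : (n%:R * eta) ^+ 2 <= alpha ^+ n.
  have -> : alpha = (1 + eta) ^+ 2.
    by rewrite /eta addrC subrK sqr_sqrtr // ltW // (lt_trans ltr01).
  rewrite exprAC lerXn2r ?nnegrE ?mulr_ge0 ?exprn_ge0 ?(ltW eta_gt0) //.
    by rewrite addr_ge0 // ltW.
  elim: n => [|n IHn]; first by rewrite mul0r expr0.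
  have : 1 <= (1 + eta) ^+ n by rewrite exprn_ege1 // lerDl ltW.
  rewrite -(ler_pM2l eta_gt0) exprS -natr1; move: IHn; lra.
exists (Num.truncn ((1 + `|C|) / (K * eta ^+ 2))).+1 => n /[dup] n_ge.
rewrite -(ler_nat R) => n_ge'.
have : (1 + `|C|) / (K * eta ^+ 2) <= n%:R.
  by apply: le_trans n_ge'; rewrite ltW // truncnS_gt.
rewrite ler_pdivrMr ?mulr_gt0 ?exprn_gt0 // => n_ge''.
have n_ge1 : 1 <= n%:R :> R by rewrite ler1n (leq_trans _ n_ge).
have C0 := normr_ge0 C.
have exponent : `|C| + n%:R <= K * alpha ^+ n.
  apply: (@le_trans _ _ (K * (n%:R * eta) ^+ 2)); last by rewrite ler_wpM2l // ltW.
  rewrite exprMn; apply: (@le_trans _ _ (n%:R * (n%:R * (K * eta ^+ 2)))); last first.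
    by rewrite le_eqVlt; apply/orP; left; apply/eqP; ring.
  apply: (@le_trans _ _ (n%:R * (1 + `|C|))); last by rewrite ler_wpM2l.
  have : 1 * `|C| <= n%:R * `|C| by rewrite ler_wpM2r.
  by lra.
apply: le_trans (_ : expR (`|C| + n%:R) <= _); last by rewrite ler_expR.
have two : 2 <= expR (1 : R) by have := expR_ge1Dx (1 : R); lra.
rewrite expRD -[n%:R]mul1r expRM_natr.
apply: (@le_trans _ _ (`|C| * 2 ^+ n)).
  by rewrite ler_wpM2r ?exprn_ge0 ?ler_norm.
rewrite ler_pM ?exprn_ge0 //; last by rewrite lerXn2r ?nnegrE ?expR_ge0.
by have := expR_ge1Dx `|C|; lra.
Qed.

Section EllAlpha.
Variables (R : realType) (alpha l1 : R).
Hypotheses (alpha_gt1 : 1 < alpha) (l1_gt0 : 0 < l1) (l1_le : l1 <= 1 / 3)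
  (l1_alpha_le : l1 `^ (alpha - 1) <= 1 / 3).

Lemma ell_alpha_gt0 s : 0 < ell_alpha alpha l1 s.
Proof. by case: s => [|s] //=; rewrite powR_gt0. Qed.

Lemma ell_alphaSS s : ell_alpha alpha l1 s.+2 =
  ell_alpha alpha l1 s.+1 * l1 `^ ((alpha - 1) * alpha ^+ s).
Proof.
rewrite /= -powRD; last by rewrite (gt_eqF l1_gt0) implybT.
by congr (_ `^ _); rewrite exprS; ring.
Qed.

Lemma ell_alpha_third s : 3 * ell_alpha alpha l1 s.+1 <= ell_alpha alpha l1 s.
Proof.
case: s => [|s]; first by rewrite /= expr0 powRr1 ?(ltW l1_gt0) //; move: l1_le; lra.
rewrite ell_alphaSS powRrM.
have : (l1 `^ (alpha - 1)) `^ (alpha ^+ s) <= 1 / 3.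
  apply: le_trans (ge1r_powR _ _) l1_alpha_le; last by rewrite exprn_ege1 // ltW.
  by rewrite powR_gt0 //=; move: l1_alpha_le; lra.
set q := _ `^ _ => q_le; have := ell_alpha_gt0 s.+1; set e := ell_alpha _ _ _ => e0.
have : e * q <= e * (1 / 3) by rewrite ler_wpM2l // ltW.
by lra.
Qed.

Lemma ell_alpha_ratio (C : R) : exists n0, forall n, (n0 <= n)%N ->
  C * 2 ^+ n * ell_alpha alpha l1 n.+1 <= ell_alpha alpha l1 n.
Proof.
have K_gt0 : 0 < - ln l1 * (alpha - 1).
  by rewrite mulr_gt0 ?subr_gt0 // oppr_gt0 ln_lt0 // l1_gt0 /=; move: l1_le; lra.
(* The factor [2] pays for the index shift: level [n.+1] involves [alpha ^+ n] but [2 ^+ n.+1]. *)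
have [n0 n0P] := expR_superexp _ _ _ (C * 2) alpha_gt1 K_gt0.
exists n0.+1 => -[|n] //; rewrite ltnS => /n0P bound.
rewrite ell_alphaSS mulrCA -[leRHS]mulr1 ler_wpM2l ?(ltW (ell_alpha_gt0 _)) //.
rewrite /powR gt_eqF // exprS mulrA.
have -> : (alpha - 1) * alpha ^+ n * ln l1 = - (- ln l1 * (alpha - 1) * alpha ^+ n).
  by ring.
by rewrite expRN ler_pdivrMr ?expR_gt0 // mul1r.
Qed.

End EllAlpha.

(** * Divergence of the Lebesgue constants *)

Theorem theorem4p6 (R : realType) (alpha l1 : R)
    (alpha_gt1 : 1 < alpha)
    (l1_gt0 : 0 < l1)
    (l1_le : l1 <= 1 / 3)
    (l1_alpha_le : l1 `^ (alpha - 1) <= 1 / 3)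
    (x : forall s : nat, 'I_(2 ^ s - 1) -> R)
    (x_inj : forall s : nat, (1 <= s)%N -> injective (x s))
    (x_cantor : forall s : nat, (1 <= s)%N ->
      forall k : 'I_(2 ^ s - 1), cantor_alpha alpha l1 (x s k))
    (x_unif : forall s : nat, (1 <= s)%N ->
      uniformly_distributed (ell_alpha alpha l1) (x s)) :
  lebesgue_constant (x s) (cantor_alpha alpha l1) @[s --> \oo] --> +oo%E.
Proof.
apply/cvgeyPge => A.
have [m A_le] : exists m, A <= (2 ^+ m - 1) / 2.
  pose m := (Num.truncn (2 * `|A|)).+1; exists m.
  have : 2 * `|A| < m%:R by rewrite truncnS_gt.
  have : m.+1%:R <= 2 ^+ m :> R by rewrite -natrX ler_nat ltn_expl.
  by rewrite -natr1; have := ler_norm A; lra.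
(* For [s = m + r.+1] the required factor [6 * 2 ^+ s.+1] equals [12 * 2 ^+ m.+1 * 2 ^+ r], and
   [r <= j] gives [2 ^+ r <= 2 ^+ j]. *)
have [n0 n0P] := ell_alpha_ratio _ _ _ alpha_gt1 l1_gt0 l1_le (12 * 2 ^+ m.+1).
exists (m + n0.+1)%N => // s /= s_ge.
have [r sE n0_le] : exists2 r, s = (m + r.+1)%N & (n0 <= r)%N.
  by exists (s - m.+1)%N; lia.
have s_gt0 : (0 < s)%N by lia.
move: (x_inj s s_gt0) (x_cantor s s_gt0) (x_unif s s_gt0); move: (x s).
rewrite {}sE => {s s_ge s_gt0} y y_inj yK y_unif.
have [|t tK sum_ge] := lebesgue_sum_ge _ _ (ell_alpha_gt0 _ _ _ l1_gt0)
  (ell_alpha_third _ _ _ alpha_gt1 l1_gt0 l1_le l1_alpha_le)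
  r m y _ y_inj yK y_unif.
  move=> j le_rj; apply: le_trans (n0P j (leq_trans n0_le le_rj)).
  rewrite mulrA ler_wpM2r ?(ltW (ell_alpha_gt0 _ _ _ l1_gt0 _)) //.
  have : 2 ^+ r <= 2 ^+ j :> R by rewrite ler_weXn2l // ler1n.
  rewrite addnS !exprS exprD => le2.
  have : 2 ^+ m * 2 ^+ r <= 2 ^+ m * 2 ^+ j :> R by rewrite ler_wpM2l ?exprn_ge0.
  by lra.
apply: (@le_trans _ _ (\sum_k `|lagrange_basis y k t|)%:E).
  by rewrite lee_fin (le_trans A_le).
by apply: ereal_sup_ubound; exists t.
Qed.
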